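(* Let $(V,\beta)$ be a symplectic space of countably infinite dimension over $GF(2)$, with a decomposition $V=\bigoplus_{i\in\omega}\langle e_i,e_i^*\rangle$ into pairwise orthogonal hyperbolic planes (each $(e_i,e_i^* )$ being a hyperbolic pair). Then the age of $(V,\beta)$ does not satisfy the Ramsey property. That is, there exist $r\in\omega$ and finite subspaces $A<B$ of $V$ such that for no finite subspace $C$ of $V$ does $C\rightarrow (B)^A_r$ hold.
   Context: A symplectic space over $GF(2)$ is a vector space $V$ over $GF(2)$ with a non-degenerate bilinear form $\beta$ that is skew symmetric and satisfies $\beta(v,v)=0$ for all $v\in V$. Non-degenerate means that $\mathsf{Rad}(V)=V^\perp=\{u\in V : \beta(u,x)=0 \text{ for all } x\in V\}$ is $0$. A hyperbolic pair is a pair $u,v$ with $\beta(u,u)=\beta(v,v)=0$ and $\beta(u,v)=1$. Substructures of $(V,\beta)$ are subspaces with the restricted form, and isomorphisms between them are linear isometries. The age of $(V,\beta)$ is the class of isomorphism types of its finite substructures. For finite structures $A$ and $C$, ${C\choose A}$ denotes the set of all substructures of $C$ isomorphic to $A$. For $A<B$ in the age, $C\rightarrow(B)^A_r$ means that for each coloring $\xi:{C\choose A}\to r$ (with $r$ colors) there is a substructure $B'\le C$ isomorphic to $B$ such that $\xi$ is constant on ${B'\choose A}$. The age has the Ramsey property if for every $r\in\omega$ and all $A<B$ in the age there is $C$ in the age with $C\rightarrow(B)^A_r$. *)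

(* Defs.v *)
From mathcomp Require Import all_boot all_order all_algebra.
From mathcomp Require Import sesquilinear finmap.

Set Implicit Arguments.
Unset Strict Implicit.
Unset Printing Implicit Defensive.

Import GRing.Theory.
Local Open Scope ring_scope.

Section Symplectic.

Variables (V : lmodType 'F_2) (beta : {skew_symmetric V}).

Definition alternating : Prop := forall v : V, beta v v = 0.

(* [nondegenerate] of sesquilinear.v requires a finite-dimensional space. *)
Definition Rad (u : V) : Prop := forall x : V, beta u x = 0.

Definition symplectic : Prop :=
  alternating /\ (forall u : V, Rad u <-> u = 0).

Definition hyperbolic_pair (u v : V) : Prop :=
  [/\ beta u u = 0, beta v v = 0 & beta u v = 1].

Definition plane (u v w : V) : Prop := exists a b : 'F_2, w = a *: u + b *: v.

Definition orthogonal_sets (U W : V -> Prop) : Prop :=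
  forall u w : V, U u -> W w -> beta u w = 0.

Definition internal_direct_sum (W : nat -> V -> Prop) : Prop :=
  (forall v : V, exists (n : nat) (w : nat -> V),
      (forall i, W i (w i)) /\ v = \sum_(i < n) w i)
  /\ (forall (n : nat) (w : nat -> V),
      (forall i, W i (w i)) -> \sum_(i < n) w i = 0 ->
      forall i, (i < n)%N -> w i = 0).

Definition orthogonal_hyperbolic_decomposition (e es : nat -> V) : Prop :=
  [/\ forall i, hyperbolic_pair (e i) (es i),
      forall i j, i <> j ->
        orthogonal_sets (plane (e i) (es i)) (plane (e j) (es j))
    & internal_direct_sum (fun i => plane (e i) (es i))].

(* The members of the age are represented by the finite subspaces of V. *)
Definition finite_subspace (A : {fset V}) : Prop :=
  GRing.submod_closed (mem A).

(* An isomorphism A -> B is a map on V of which only the values on A matter. *)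
Definition isomorphic (A B : {fset V}) : Prop :=
  exists f : V -> V,
    [/\ forall a : 'F_2,
          {in A &, forall u v, f (a *: u + v) = a *: f u + f v},
        {in A &, injective f},
        (f @` A)%fset = B
      & {in A &, forall u v, beta (f u) (f v) = beta u v}].

(* A' is an element of binom(C, A). *)
Definition copy_in (C A A' : {fset V}) : Prop :=
  [/\ finite_subspace A', (A' `<=` C)%fset & isomorphic A A'].

(* A coloring of binom(C, A) by r = {0, ..., r - 1} is given by a function on
   all of {fset V} whose values on binom(C, A) are below r; its other values
   are irrelevant. *)
Definition arrows (C B A : {fset V}) (r : nat) : Prop :=
  forall xi : {fset V} -> nat,
    (forall A', copy_in C A A' -> (xi A' < r)%N) ->
    exists2 B', copy_in C B B' &
      forall A1 A2, copy_in B' A A1 -> copy_in B' A A2 -> xi A1 = xi A2.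

Definition age_has_Ramsey_property : Prop :=
  forall (r : nat) (A B : {fset V}),
    finite_subspace A -> finite_subspace B -> (A `<` B)%fset ->
    exists2 C, finite_subspace C & arrows C B A r.

End Symplectic.

(* Main.v *)
(** The quadratic form [Q v = \sum_i a_i a_i^*], where [a_i] and [a_i^*] are the
    coordinates of [v] at [e_i] and [e_i^*], satisfies
    [Q (u + v) = Q u + Q v + beta u v]; for the vectors of a finite subspace
    finitely many [i] suffice.  Colour the line [{0, v}] by [Q v].  If [Q] is
    constant, say equal to [c], on the nonzero vectors of a copy of a space
    containing [e_0], [e_0^*] and [e_1], then the hyperbolic pair [e_0, e_0^*]
    gives [c = c + c + 1 = 1] and the orthogonal pair [e_0, e_1] gives
    [c = c + c = 0]. *)

Require Import Defs.
From mathcomp Require Import all_boot all_order all_algebra.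
From mathcomp Require Import sesquilinear finmap.

Import GRing.Theory.
Local Open Scope ring_scope.

Lemma F2_eq0_or_eq1 (a : 'F_2) : a = 0 \/ a = 1.
Proof. by case: a => -[|[|//]] ?; [left | right]; apply: val_inj. Qed.

Lemma addFF2 (a : 'F_2) : a + a = 0.
Proof. by case: (F2_eq0_or_eq1 a) => ->; apply: val_inj. Qed.

Lemma addvv_F2 (V : lmodType 'F_2) (v : V) : v + v = 0.
Proof. by rewrite -[v]scale1r -scalerDl addFF2 scale0r. Qed.

Lemma skew_symmetric_F2 (V : lmodType 'F_2) (beta : {skew_symmetric V})
  (u v : V) : beta v u = beta u v.
Proof.
rewrite (hermC beta v u) expr1 mulN1r /=.
by case: (F2_eq0_or_eq1 (beta u v)) => ->; apply: val_inj.
Qed.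

Lemma finite_subspace0 (V : lmodType 'F_2) : finite_subspace [fset (0 : V)]%fset.
Proof.
split=> [|a u v]; rewrite ?inE // => /eqP-> /eqP->.
by rewrite scaler0 addr0.
Qed.

Lemma finite_subspaceD (V : lmodType 'F_2) (B : {fset V}) (u v : V) :
  finite_subspace B -> u \in B -> v \in B -> u + v \in B.
Proof. by move=> [_ BD] uB vB; rewrite -[u]scale1r; apply: BD. Qed.

(** Over GF(2) the span of [B] and [x] is [B] together with the coset [x + B]: two elements of the
    coset sum to an element of [B] because [x + x = 0]. *)
Lemma finite_subspace_adjoin (V : lmodType 'F_2) (B : {fset V}) (x : V) :
  finite_subspace B -> finite_subspace (B `|` [fset (x + b)%R | b in B])%fset.
Proof.
move=> Bsub; have BD := finite_subspaceD _ _ _ _ Bsub.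
have B0 : 0 \in B by case: Bsub.
have shift v : v \in B -> x + v \in (B `|` [fset (x + b)%R | b in B])%fset.
  by move=> vB; rewrite in_fsetU (in_imfset _ (fun b => x + b)) ?orbT.
have stay v : v \in B -> v \in (B `|` [fset (x + b)%R | b in B])%fset.
  by move=> vB; rewrite in_fsetU vB.
split=> [|a u v]; first exact: stay.
case: (F2_eq0_or_eq1 a) => ->; rewrite ?scale0r ?add0r ?scale1r //.
case/fsetUP=> [uB|/imfsetP[b /= bB ->]]; case/fsetUP=> [vB|/imfsetP[c /= cB ->]].
- exact/stay/BD.
- by rewrite addrCA; apply/shift/BD.
- by rewrite -addrA; apply/shift/BD.
- by rewrite addrACA addvv_F2 add0r; apply/stay/BD.
Qed.

Lemma finite_subspace_span (V : lmodType 'F_2) (s : seq V) :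
  exists2 B : {fset V}, finite_subspace B & {subset s <= B}.
Proof.
elim: s => [|x s [B Bsub sB]]; first by exists [fset 0]%fset => //; apply: finite_subspace0.
exists (B `|` [fset (x + b)%R | b in B])%fset; first exact: finite_subspace_adjoin.
move=> y; rewrite in_cons in_fsetU => /predU1P[->|/sB-> //].
by apply/orP; right; apply/imfsetP; exists 0; rewrite ?addr0 //; case: Bsub.
Qed.

Lemma finite_subspace_line (V : lmodType 'F_2) (x : V) :
  finite_subspace [fset 0; x]%fset.
Proof.
split=> [|a u v]; rewrite ?fset21 //.
case: (F2_eq0_or_eq1 a) => ->; rewrite ?scale0r ?add0r ?scale1r //.
by move=> /fset2P[]-> /fset2P[]->; rewrite ?addr0 ?add0r ?addvv_F2 ?fset21 ?fset22.
Qed.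

(** The bijection fixing 0 is linear because 1 is the only nonzero scalar, and the form vanishes on
    both lines. Hence every line is a copy of every other, and colouring copies of a line amounts to
    colouring nonzero vectors. *)
Lemma isomorphic_line (V : lmodType 'F_2) (beta : {skew_symmetric V}) (x y : V) :
  alternating beta -> x != 0 -> y != 0 ->
  isomorphic beta [fset 0; x]%fset [fset 0; y]%fset.
Proof.
move=> alt x0 y0; pose f (v : V) : V := if v == 0 then 0 else y.
have f0 : f 0 = 0 by rewrite /f eqxx.
have fx : f x = y by rewrite /f (negPf x0).
exists f; split.
- move=> a u v; case: (F2_eq0_or_eq1 a) => ->;
    rewrite ?scale0r ?add0r ?scale1r // => /fset2P[]-> /fset2P[]->;
    by rewrite ?addr0 ?add0r ?addvv_F2 ?f0 ?fx ?addr0 ?add0r ?addvv_F2.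
- move=> u v /fset2P[]-> /fset2P[]->; rewrite ?f0 ?fx // => /eqP.
    by rewrite eq_sym (negPf y0).
  by rewrite (negPf y0).
- by rewrite imfset_fset2 f0 fx.
- by move=> u v /fset2P[]-> /fset2P[]->; rewrite ?f0 ?fx ?linear0l ?linear0r ?alt.
Qed.

Lemma mem_plane_l (V : lmodType 'F_2) (u v : V) : plane u v u.
Proof. by exists 1, 0; rewrite scale1r scale0r addr0. Qed.

Lemma mem_plane_r (V : lmodType 'F_2) (u v : V) : plane u v v.
Proof. by exists 0, 1; rewrite scale1r scale0r add0r. Qed.

(** The coordinates of [u] at [e i] and [es i] are [beta u (es i)] and [beta (e i) u]. Only [u] is
    expanded, so the bound [n] depends on [u] alone and serves every [v]. *)
Lemma form_coordinates (V : lmodType 'F_2) (beta : {skew_symmetric V})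
    (e es : nat -> V) (u : V) :
  orthogonal_hyperbolic_decomposition beta e es ->
  exists n, forall N, (n <= N)%N -> forall v,
    beta u v = \sum_(i < N) (beta u (es i) * beta (e i) v
                             + beta v (es i) * beta (e i) u).
Proof.
case=> hyp orth [/(_ u)[n [w [wP ->]]] _]; exists n => N le_nN v.
rewrite linear_sumlz.
under [RHS]eq_bigr => i _ do
  rewrite linear_sumlz linear_sumr mulr_suml mulr_sumr -big_split.
(* The component [w j] is orthogonal to all planes but the [j]-th, so after the exchange only the
   term [i = j] of the inner sum survives. *)
rewrite exchange_big; apply: eq_bigr => j _ /=.
have lt_jN : (j < N)%N by apply: leq_trans le_nN.
have [pe pes] := (fun i => mem_plane_l _ (e i) (es i), fun i => mem_plane_r _ (e i) (es i)).
rewrite (bigD1 (Ordinal lt_jN)) //= big1 => [|i neq_ij]; last first.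
  have ne : nat_of_ord i <> j by move=> eq_ij; case/eqP: neq_ij; apply: val_inj.
  rewrite (skew_symmetric_F2 _ _ (es i) (w j)).
  by rewrite !(orth i j ne _ (w j)) ?mulr0 ?mul0r ?addr0.
have [ee ss es1] := hyp j; have [a [b ->]] := wP j.
rewrite !linearDl !linearDr !linearZl_LR !linearZ_LR /= ss ee es1.
rewrite !mulr0 !addr0 !add0r !mulr1 [beta v _ * b]mulrC.
by rewrite (skew_symmetric_F2 _ _ (es j) v).
Qed.

(** Expanding the products of coordinates of [u + v] leaves as cross terms exactly the coordinate
    expression of [beta u v]. The sum defining [Q] is cut at one [N] that is large enough for every
    [u] in [C]. *)
Lemma quadratic_refinement (V : lmodType 'F_2) (beta : {skew_symmetric V})
    (e es : nat -> V) (C : {fset V}) :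
  orthogonal_hyperbolic_decomposition beta e es ->
  exists Q : V -> 'F_2, {in C, forall u v, Q (u + v) = Q u + Q v + beta u v}.
Proof.
move=> dec.
have [N NP] : exists N, {in C, forall u v,
    beta u v = \sum_(i < N) (beta u (es i) * beta (e i) v
                             + beta v (es i) * beta (e i) u)}.
  suff [n nP] : exists n, forall u, u \in enum_fset C -> forall N, (n <= N)%N ->
      forall v, beta u v = \sum_(i < N) (beta u (es i) * beta (e i) v
                                         + beta v (es i) * beta (e i) u).
    by exists n => u uC v; apply: nP.
  elim: (enum_fset C) => [|x s [n nP]]; first by exists 0%N.
  have [m mP] := form_coordinates _ _ _ _ x dec.
  exists (maxn m n) => u; rewrite in_cons => /predU1P[->|us] N.
    by rewrite geq_max => /andP[/mP].
  by rewrite geq_max => /andP[_ /nP]; apply.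
exists (fun v => \sum_(i < N) beta v (es i) * beta (e i) v) => u uC v.
rewrite (NP u uC v) -!big_split; apply: eq_bigr => i _ /=.
by rewrite linearDl linearDr mulrDl !mulrDr [X in _ + X = _]addrC addrACA.
Qed.

Theorem theorem2p3 (V : lmodType 'F_2) (beta : {skew_symmetric V})
    (e es : nat -> V) :
  symplectic beta ->
  orthogonal_hyperbolic_decomposition beta e es ->
  ~ age_has_Ramsey_property beta /\
  (exists (r : nat) (A B : {fset V}),
    [/\ finite_subspace A, finite_subspace B, (A `<` B)%fset
      & ~ (exists2 C : {fset V}, finite_subspace C & arrows beta C B A r)]).
Proof.
move=> [alt _] dec.
suff [r [A [B [Asub Bsub ltAB noC]]]] : exists (r : nat) (A B : {fset V}),
    [/\ finite_subspace A, finite_subspace B, (A `<` B)%fset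
      & ~ (exists2 C : {fset V}, finite_subspace C & arrows beta C B A r)].
  split; last by exists r, A, B.
  by move=> ramsey; apply/noC/ramsey.
have [B Bsub sB] := finite_subspace_span V [:: e 0%N; es 0%N; e 1%N].
have [hyp orth _] := dec.
have [ee0 _ e0es0] := hyp 0%N; have [_ _ e1es1] := hyp 1%N.
have e0B : e 0%N \in B by apply: sB; rewrite !inE eqxx.
have es0B : es 0%N \in B by apply: sB; rewrite !inE eqxx orbT.
have e1B : e 1%N \in B by apply: sB; rewrite !inE eqxx !orbT.
have [pe pes] := (fun i => mem_plane_l _ (e i) (es i), fun i => mem_plane_r _ (e i) (es i)).
have e0e1 : beta (e 0%N) (e 1%N) = 0 by apply: (orth 0%N 1%N).
have e1es0 : beta (e 1%N) (es 0%N) = 0 by apply: (orth 1%N 0%N).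
(* Every vector that has to span a line is shown to be nonzero by pairing it with a suitable
   partner. *)
have nz u v : beta u v = 1 -> u != 0.
  by move=> uv1; apply/eqP => u0; move: uv1; rewrite u0 linear0l => /eqP.
have [e0_neq0 e1_neq0] := (nz _ _ e0es0, nz _ _ e1es1).
have es0_neq0 : es 0%N != 0 by apply: nz (_ : _ (e 0%N) = 1); rewrite skew_symmetric_F2.
exists 2%N, [fset 0; e 0%N]%fset, B; split => //.
- exact: finite_subspace_line.
- rewrite fproperE; apply/andP; split; first apply/fsubsetP.
    by move=> u /fset2P[]-> //; case: Bsub.
  apply/fsubsetPn; exists (es 0%N); rewrite // !inE negb_or es0_neq0 /=.
  by apply/eqP => es0e0; move: e0es0; rewrite es0e0 ee0 => /eqP.
move=> [C _ arr]; have [Q QD] := quadratic_refinement _ _ _ _ C dec.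
(* A colouring must be defined on all finite sets; on a line [{0, v}] this one is 1 exactly when
   [Q v = 0]. *)
pose xi (L : {fset V}) : nat := has (fun v => (v != 0) && (Q v == 0)) (enum_fset L).
have [|B' [_ B'C [f [f_lin f_inj fB f_iso]]] mono] := arr xi.
  by move=> L _; rewrite /xi; case: has.
have xi_line v : v != 0 -> xi [fset 0; v]%fset = (Q v == 0).
  move=> v0; congr nat_of_bool; apply/hasP/idP => [[w /fset2P[]->]|Qv].
  - by rewrite eqxx.
  - by case/andP.
  - by exists v; rewrite ?v0 //; apply: fset22.
have B0 : 0 \in B by case: Bsub.
have f0 : f 0 = 0.
  by have := f_lin 1 _ _ B0 B0; rewrite !scale1r addr0 addvv_F2.
have fD u v : u \in B -> v \in B -> f (u + v) = f u + f v.
  by move=> uB vB; have := f_lin 1 _ _ uB vB; rewrite !scale1r.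
have f_neq0 u : u \in B -> u != 0 -> f u != 0.
  by move=> uB; apply: contra_neq => fu0; apply: f_inj; rewrite ?f0.
have fB' u : u \in B -> f u \in B' by move=> uB; rewrite -fB in_imfset.
have f_copy u : u \in B -> u != 0 ->
    copy_in beta B' [fset 0; e 0%N]%fset [fset 0; f u]%fset.
  move=> uB u0; split; first exact: finite_subspace_line.
    by apply/fsubsetP => w /fset2P[]->; [rewrite -f0|]; apply: fB'.
  by apply: isomorphic_line => //; apply: f_neq0.
(* Equal colours force equal values of [Q], since an element of GF(2) is determined by whether it is
   0. *)
have Q_const u : u \in B -> u != 0 -> Q (f u) = Q (f (e 0%N)).
  move=> uB u0; have := mono _ _ (f_copy _ uB u0) (f_copy _ e0B e0_neq0).
  rewrite !xi_line ?f_neq0 //.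
  by case: (F2_eq0_or_eq1 (Q (f u))) (F2_eq0_or_eq1 (Q (f (e 0%N)))) => -> [] ->.
(* With [c] the constant value of [Q] on the nonzero vectors of [B'], the refinement identity reads
   [c = c + c + beta u v], where [f] being an isometry brings the form back to [B]. *)
have Q_sum u v : u \in B -> v \in B -> u != 0 -> v != 0 -> u + v != 0 ->
    Q (f (e 0%N)) = beta u v.
  move=> uB vB u0 v0 uv0.
  rewrite -(Q_const (u + v)) ?finite_subspaceD // fD //.
  rewrite QD ?(fsubsetP B'C) ?fB' //.
  by rewrite !Q_const // addFF2 add0r f_iso.
have e0es0_neq0 : e 0%N + es 0%N != 0.
  by apply: nz (_ : _ (es 0%N) = 1); rewrite linearDl /= e0es0 alt addr0.
have e0e1_neq0 : e 0%N + e 1%N != 0.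
  by apply: nz (_ : _ (es 0%N) = 1); rewrite linearDl /= e0es0 e1es0 addr0.
have := Q_sum _ _ e0B e1B e0_neq0 e1_neq0 e0e1_neq0.
rewrite (Q_sum _ _ e0B es0B e0_neq0 es0_neq0 e0es0_neq0) e0es0 e0e1.
by move/eqP.
Qed.
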